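(* Let $\mathcal{D}$ be a triangulated category and let $S$ be an object of $\mathcal{D}$ such that the graded ring $\pi_*S$ is Noetherian. Then the generating hypothesis is true in $\mathcal{D}$ (with respect to $S$) if and only if $\mathbf{thick}\langle S\rangle$ is exactly the collection of retracts of finite wedges of suspensions of $S$.
   Context: For an object $S$ of a triangulated category $\mathcal{D}$ with suspension $\Sigma$, write $\pi_i X=[S,X]_i=\operatorname{Hom}_{\mathcal{D}}(\Sigma^i S,X)$ for $i\in\mathbb{Z}$ and $\pi_*X=\bigoplus_i\pi_iX$; $\pi_*S$ is a graded ring under composition, not assumed commutative or concentrated in degree zero, and $\pi_*X$ is a graded right $\pi_*S$-module. The thick subcategory $\mathbf{thick}\langle S\rangle$ is the smallest class of objects of $\mathcal{D}$ containing $S$ and closed under (de)suspension, retracts, and cofiber sequences (if two of three objects in an exact triangle belong to it, so does the third). The generating hypothesis in $\mathcal{D}$ (with respect to $S$) is the statement: if $f:X\to Y$ is a morphism between objects of $\mathbf{thick}\langle S\rangle$ and $\pi_*f=0$, then $f=0$. A finite wedge of suspensions of $S$ is a finite coproduct of objects $\Sigma^{n}S$, $n\in\mathbb{Z}$. *)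

(* Defs.v *)
From mathcomp Require Import all_boot all_order all_algebra.
Set Implicit Arguments.
Unset Strict Implicit.
Unset Printing Implicit Defensive.
Import GRing.Theory.
Local Open Scope ring_scope.

Declare Scope cat_scope.
Delimit Scope cat_scope with cat.

Record preadditive : Type := Preadditive {
  ob :> Type;
  hom : ob -> ob -> zmodType;
  idm : forall X, hom X X;
  comp : forall X Y Z, hom Y Z -> hom X Y -> hom X Z;
  compA : forall X Y Z W (h : hom Z W) (g : hom Y Z) (f : hom X Y),
    comp h (comp g f) = comp (comp h g) f;
  comp1m : forall X Y (f : hom X Y), comp (idm Y) f = f;
  compm1 : forall X Y (f : hom X Y), comp f (idm X) = f;
  compDl : forall X Y Z (g g' : hom Y Z) (f : hom X Y),
    comp (g + g') f = comp g f + comp g' f;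
  compDr : forall X Y Z (g : hom Y Z) (f f' : hom X Y),
    comp g (f + f') = comp g f + comp g f' }.

Arguments hom {p} X Y.
Arguments idm {p} X.
Arguments comp {p X Y Z} g f.

Notation "g \oc f" := (comp g f)
  (at level 40, left associativity) : cat_scope.
Local Open Scope cat_scope.

Record add_functor (C : preadditive) : Type := AddFunctor {
  fobj :> C -> C;
  fmap : forall X Y : C, hom X Y -> hom (fobj X) (fobj Y);
  fmap1 : forall X : C, fmap (idm X) = idm (fobj X);
  fmapM : forall (X Y Z : C) (g : hom Y Z) (f : hom X Y),
    fmap (g \oc f) = fmap g \oc fmap f;
  fmapD : forall (X Y : C) (f g : hom X Y), fmap (f + g) = fmap f + fmap g }.

Arguments fmap {C} a {X Y} f.

Section Basics.
Variable C : preadditive.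

Definition is_iso (X Y : C) (f : hom X Y) : Prop :=
  exists g : hom Y X, g \oc f = idm X /\ f \oc g = idm Y.

Definition is_zero (X : C) : Prop := idm X = 0.

Definition retract (X Y : C) : Prop :=
  exists (i : hom X Y) (r : hom Y X), r \oc i = idm X.

Definition is_coproduct n (F : 'I_n -> C) (W : C)
    (inj : forall k, hom (F k) W) : Prop :=
  forall (Z : C) (g : forall k, hom (F k) Z),
    exists! h : hom W Z, forall k, h \oc inj k = g k.

Definition functor1 : add_functor C :=
  @AddFunctor C id (fun _ _ f => f) (fun _ => erefl)
    (fun _ _ _ _ _ => erefl) (fun _ _ _ _ => erefl).

Lemma functor_comp_subproof1 (G F : add_functor C) (X : C) :
  fmap G (fmap F (idm X)) = idm (G (F X)).
Proof. by rewrite !fmap1. Qed.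

Lemma functor_comp_subproofM (G F : add_functor C) (X Y Z : C)
    (g : hom Y Z) (f : hom X Y) :
  fmap G (fmap F (g \oc f)) = fmap G (fmap F g) \oc fmap G (fmap F f).
Proof. by rewrite !fmapM. Qed.

Lemma functor_comp_subproofD (G F : add_functor C) (X Y : C)
    (f g : hom X Y) :
  fmap G (fmap F (f + g)) = fmap G (fmap F f) + fmap G (fmap F g).
Proof. by rewrite !fmapD. Qed.

Definition functor_comp (G F : add_functor C) : add_functor C :=
  @AddFunctor C (fun X => G (F X)) (fun _ _ f => fmap G (fmap F f))
    (@functor_comp_subproof1 G F) (@functor_comp_subproofM G F)
    (@functor_comp_subproofD G F).

Fixpoint functor_iter (F : add_functor C) (n : nat) : add_functor C :=
  if n is m.+1 then functor_comp F (functor_iter F m) else functor1.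

End Basics.

Definition eq_hom (C : preadditive) (X Y : C) (e : X = Y) : hom X Y :=
  match e in _ = Z return hom X Z with erefl => idm X end.

(* The suspension is an additive autoequivalence, with quasi-inverse
   [desusp].  The natural isomorphisms [sunit : 1 -> Omega Sigma] and
   [scunit : 1 -> Sigma Omega] (the latter being the inverse of the counit)
   form an adjoint equivalence: [sunitE] and [scunitE] are the triangle
   identities, with the counit moved to the other side.  The coproduct of the
   empty family, [n = 0] in [finite_coproducts], is the zero object.
   The axioms TR1 (dist_iso, dist_id, dist_cone), TR2 (dist_rot),
   TR3 (dist_mor) and TR4 (dist_oct) are those of Verdier. *)
Record triangulated : Type := Triangulated {
  tcat :> preadditive;
  finite_coproducts : forall n (F : 'I_n -> tcat),
    exists (W : tcat) (inj : forall k, hom (F k) W), is_coproduct inj;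

  susp : add_functor tcat;
  desusp : add_functor tcat;
  sunit : forall X : tcat, hom X (desusp (susp X));
  scunit : forall X : tcat, hom X (susp (desusp X));
  sunit_iso : forall X, is_iso (sunit X);
  scunit_iso : forall X, is_iso (scunit X);
  sunit_nat : forall (X Y : tcat) (f : hom X Y),
    sunit Y \oc f = fmap desusp (fmap susp f) \oc sunit X;
  scunit_nat : forall (X Y : tcat) (f : hom X Y),
    scunit Y \oc f = fmap susp (fmap desusp f) \oc scunit X;
  sunitE : forall X, fmap susp (sunit X) = scunit (susp X);
  scunitE : forall X, fmap desusp (scunit X) = sunit (desusp X);

  (* [dist f g h]: X -f-> Y -g-> Z -h-> Sigma X is an exact triangle *)
  dist : forall X Y Z : tcat,
    hom X Y -> hom Y Z -> hom Z (susp X) -> Prop;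

  dist_iso : forall (X Y Z X' Y' Z' : tcat)
      (f : hom X Y) (g : hom Y Z) (h : hom Z (susp X))
      (f' : hom X' Y') (g' : hom Y' Z') (h' : hom Z' (susp X'))
      (a : hom X X') (b : hom Y Y') (c : hom Z Z'),
    is_iso a -> is_iso b -> is_iso c ->
    b \oc f = f' \oc a -> c \oc g = g' \oc b ->
    fmap susp a \oc h = h' \oc c ->
    dist f g h -> dist f' g' h';
  dist_id : forall X Z : tcat, is_zero Z ->
    dist (idm X) (0 : hom X Z) (0 : hom Z (susp X));
  dist_cone : forall (X Y : tcat) (f : hom X Y),
    exists (Z : tcat) (g : hom Y Z) (h : hom Z (susp X)), dist f g h;

  dist_rot : forall (X Y Z : tcat)
      (f : hom X Y) (g : hom Y Z) (h : hom Z (susp X)),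
    dist f g h <-> dist g h (- fmap susp f);

  dist_mor : forall (X Y Z X' Y' Z' : tcat)
      (f : hom X Y) (g : hom Y Z) (h : hom Z (susp X))
      (f' : hom X' Y') (g' : hom Y' Z') (h' : hom Z' (susp X'))
      (a : hom X X') (b : hom Y Y'),
    dist f g h -> dist f' g' h' -> b \oc f = f' \oc a ->
    exists c : hom Z Z',
      c \oc g = g' \oc b /\ fmap susp a \oc h = h' \oc c;

  dist_oct : forall (X Y Z U V W : tcat) (f : hom X Y) (g : hom Y Z)
      (f1 : hom Y U) (f2 : hom U (susp X))
      (g1 : hom Z V) (g2 : hom V (susp Y))
      (h1 : hom Z W) (h2 : hom W (susp X)),
    dist f f1 f2 -> dist g g1 g2 -> dist (g \oc f) h1 h2 ->
    exists (u : hom U W) (v : hom W V),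
      [/\ dist u v (fmap susp f1 \oc g2),
          u \oc f1 = h1 \oc g, h2 \oc u = f2,
          v \oc h1 = g1 & g2 \oc v = fmap susp f \oc h2] }.

Arguments susp {t}.
Arguments desusp {t}.
Arguments sunit {t} X.
Arguments scunit {t} X.
Arguments dist {t X Y Z} f g h.

Definition zsucc (i : int) : int :=
  match i with
  | Posz n => Posz n.+1
  | Negz 0 => Posz 0
  | Negz n.+1 => Negz n
  end.

Definition zpred (i : int) : int :=
  match i with
  | Posz 0 => Negz 0
  | Posz n.+1 => Posz n
  | Negz n => Negz n.+1
  end.

(* Addition of integers by recursion on the first argument, parallel to the
   definition of [shift], so that [shift_split'] involves no transport. *)
Definition zadd (i j : int) : int :=
  match i with
  | Posz m => iter m zsucc j
  | Negz m => iter m.+1 zpred j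
  end.

Lemma zsuccE i : zsucc i = i + 1.
Proof.
case: i => [n|[|n]] //=; first by rewrite -PoszD addn1.
by rewrite !NegzE -[n.+2]addn1 PoszD opprD addrNK.
Qed.

Lemma zpredE i : zpred i = i - 1.
Proof.
case: i => [[|n]|n] //=; first by rewrite -[n.+1]addn1 PoszD addrK.
by rewrite !NegzE -[n.+2]addn1 PoszD opprD.
Qed.

Lemma zaddE i j : i + j = zadd i j.
Proof.
case: i => m.
  rewrite /zadd; elim: m => [|m IHm]; first by rewrite add0r.
  by rewrite [RHS]/= -IHm zsuccE -[m.+1]addn1 PoszD addrAC.
rewrite NegzE -[RHS]/(iter m.+1 zpred j).
elim: m => [|m IHm]; first by rewrite /= zpredE addrC.
rewrite -[RHS]/(zpred (iter m.+1 zpred j)) -IHm zpredE.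
by rewrite -[m.+2]addn1 PoszD opprD addrAC.
Qed.

Section Homotopy.
Variable D : triangulated.

Definition shift (i : int) : add_functor D :=
  match i with
  | Posz n => functor_iter susp n
  | Negz n => functor_iter desusp n.+1
  end.

Definition shift_succ (i : int) (X : D) :
    hom (shift (zsucc i) X) (susp (shift i X)) :=
  match i with
  | Posz n => idm (susp (shift (Posz n) X))
  | Negz 0 => scunit X
  | Negz n.+1 => scunit (shift (Negz n) X)
  end.

Definition shift_pred (i : int) (X : D) :
    hom (shift (zpred i) X) (desusp (shift i X)) :=
  match i with
  | Posz 0 => idm (desusp X)
  | Posz n.+1 => sunit (shift (Posz n) X)
  | Negz n => idm (desusp (shift (Negz n) X))
  end.

Fixpoint shift_split_pos (m : nat) (j : int) (X : D) :
    hom (shift (iter m zsucc j) X) (functor_iter susp m (shift j X)) :=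
  if m is m'.+1
  then fmap susp (shift_split_pos m' j X) \oc shift_succ (iter m' zsucc j) X
  else idm (shift j X).

Fixpoint shift_split_neg (m : nat) (j : int) (X : D) :
    hom (shift (iter m zpred j) X) (functor_iter desusp m (shift j X)) :=
  if m is m'.+1
  then fmap desusp (shift_split_neg m' j X) \oc shift_pred (iter m' zpred j) X
  else idm (shift j X).

Definition shift_split' (i j : int) (X : D) :
    hom (shift (zadd i j) X) (shift i (shift j X)) :=
  match i with
  | Posz m => shift_split_pos m j X
  | Negz m => shift_split_neg m.+1 j X
  end.

(* The canonical isomorphism Sigma^(i+j) X -> Sigma^i Sigma^j X *)
Definition shift_split (i j : int) (X : D) :
    hom (shift (i + j) X) (shift i (shift j X)) :=
  shift_split' i j X \oc eq_hom (congr1 (fun k => shift k X) (zaddE i j)).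

Variable S : D.

Definition pi (i : int) (X : D) : zmodType := hom (shift i S) X.

Definition pi_map (i : int) (X Y : D) (f : hom X Y) (x : pi i X) : pi i Y :=
  f \oc x.

(* The right action of the graded ring pi_* S on pi_* X; for [X = S] this is
   the multiplication of pi_* S. *)
Definition pi_mul (X : D) (i j : int) (x : pi i X) (r : pi j S) :
    pi (i + j) X :=
  x \oc fmap (shift i) r \oc shift_split i j S.

(* A homogeneous right ideal of pi_* S, given by its graded pieces *)
Record right_ideal (I : forall n, pi n S -> Prop) : Prop := RightIdeal {
  right_ideal0 : forall n, I n 0;
  right_idealB : forall n (x y : pi n S), I n x -> I n y -> I n (x - y);
  right_idealM : forall i j (x : pi i S) (r : pi j S),
    I i x -> I (i + j) (pi_mul x r) }.

(* Generated by finitely many homogeneous elements: the [g k] lie in [I], and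
   every right ideal containing them contains [I]. *)
Definition fin_gen (I : forall n, pi n S -> Prop) : Prop :=
  exists (m : nat) (d : 'I_m -> int) (g : forall k, pi (d k) S),
    (forall k, I (d k) (g k)) /\
    forall J : forall n, pi n S -> Prop,
      right_ideal J -> (forall k, J (d k) (g k)) ->
      forall n (x : pi n S), I n x -> J n x.

(* Right Noetherian (pi_* X being a right module), in the graded sense: every
   homogeneous right ideal is finitely generated.  This follows at once from
   the finite generation of all right ideals of the underlying ring. *)
Definition pi_noetherian : Prop :=
  forall I : forall n, pi n S -> Prop, right_ideal I -> fin_gen I.

Record is_thick (P : D -> Prop) : Prop := IsThick {
  thick_susp : forall X, P X -> P (susp X);
  thick_desusp : forall X, P X -> P (desusp X);
  thick_retract : forall X Y, retract X Y -> P Y -> P X;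
  thick_cof3 : forall (X Y Z : D)
      (f : hom X Y) (g : hom Y Z) (h : hom Z (susp X)),
    dist f g h -> P X -> P Y -> P Z;
  thick_cof2 : forall (X Y Z : D)
      (f : hom X Y) (g : hom Y Z) (h : hom Z (susp X)),
    dist f g h -> P X -> P Z -> P Y;
  thick_cof1 : forall (X Y Z : D)
      (f : hom X Y) (g : hom Y Z) (h : hom Z (susp X)),
    dist f g h -> P Y -> P Z -> P X }.

Definition thick (X : D) : Prop :=
  forall P : D -> Prop, is_thick P -> P S -> P X.

Definition generating_hypothesis : Prop :=
  forall (X Y : D) (f : hom X Y), thick X -> thick Y ->
    (forall i (x : pi i X), pi_map f x = 0) -> f = 0.

Definition finite_wedge (W : D) : Prop :=
  exists (n : nat) (d : 'I_n -> int) (inj : forall k, hom (shift (d k) S) W),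
    is_coproduct inj.

End Homotopy.

(* Main.v *)
Require Import Defs.
From mathcomp Require Import all_boot all_order all_algebra.
Import Defs.

(** The implication from right to left needs no hypothesis on [S]: a map out of
    a finite wedge of suspensions of [S] is determined by its restrictions to
    the summands, which are elements of homotopy groups, and this property
    passes to retracts ([eq0_retract_wedge]).

    Conversely, assume the generating hypothesis and let [X] be in the thick
    subcategory.  If [pi_* X] is finitely generated, its generators assemble
    into a map [p : W -> X] from a finite wedge which is surjective on [pi_*].
    In the triangle [W -p-> X -g-> C -> Sigma W] the map [g] then vanishes on
    [pi_*], because [g p = 0]; as [C] is again in the thick subcategory,
    [g = 0], so the identity of [X] lifts along [p] and [X] is a retract of [W]
    ([retract_of_surj]).

    It remains to see that [pi_* X] is finitely generated.  Noetherianity of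
    [pi_* X] passes to extensions because [pi_*] is exact
    ([noetherian_extension]), to retracts and to (de)suspensions, so it defines
    a thick class, which contains [S] ([noetherian_thick]).

    Instead of graded submodules of [pi_* X] for the ring [pi_* S], the argument
    uses subfunctors of [T |-> hom T X], where [T] ranges over the full
    subcategory of all [Sigma^i S].  The two notions agree, since every map
    [Sigma^j S -> Sigma^i S] comes from an element of [pi_(j-i) S]; but for a
    subfunctor the ring action is plain composition, so that none of the
    coherence isomorphisms [Sigma^(i+j) S = Sigma^i Sigma^j S] intervene.  Only
    the easy comparison is used: a subfunctor is a right ideal, hence
    finiteness for right ideals gives finiteness for subfunctors. *)

Set Implicit Arguments.
Unset Strict Implicit.
Unset Printing Implicit Defensive.
Import GRing.Theory.
Local Open Scope ring_scope.
Local Open Scope cat_scope.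

(** * Dependent functions on ordinals *)

(** Equality in the total space of [T] expresses the two conditions on [f k]
    at once, without transport along an equation for [k]. *)
Lemma ord_fun_cons n (T : 'I_n.+1 -> Type) (u : T ord0)
    (w : forall k, T (lift ord0 k)) :
  exists f : forall k, T k, f ord0 = u /\ forall k, f (lift ord0 k) = w k.
Proof.
pose total k := if unlift ord0 k is Some j then Tagged T (w j) else Tagged T u.
have [f fE] : exists f : forall k, T k, forall k, Tagged T (f k) = total k.
  apply: (@fin_all_exists _ _ (fun k v => Tagged T v = total k)) => k.
  by rewrite /total; case: unliftP => [j|] ->; [exists (w j) | exists u].
exists f; split=> [|k]; apply: eq_from_Tagged; rewrite fE /total.
  by rewrite unlift_none.
by rewrite liftK.
Qed.

(** * Preadditive categories and additive functors *)

Section Preadditive.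
Variable C : preadditive.

Lemma comp0l (X Y Z : C) (f : hom X Y) : (0 : hom Y Z) \oc f = 0.
Proof. by apply: (addrI (0 \oc f)); rewrite -compDl !addr0. Qed.

Lemma comp0r (X Y Z : C) (g : hom Y Z) : g \oc (0 : hom X Y) = 0.
Proof. by apply: (addrI (g \oc 0)); rewrite -compDr !addr0. Qed.

Lemma compNl (X Y Z : C) (g : hom Y Z) (f : hom X Y) :
  (- g) \oc f = - (g \oc f).
Proof. by apply: (addrI (g \oc f)); rewrite -compDl !subrr comp0l. Qed.

Lemma compNr (X Y Z : C) (g : hom Y Z) (f : hom X Y) :
  g \oc (- f) = - (g \oc f).
Proof. by apply: (addrI (g \oc f)); rewrite -compDr !subrr comp0r. Qed.

Lemma compBl (X Y Z : C) (g g' : hom Y Z) (f : hom X Y) :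
  (g - g') \oc f = g \oc f - g' \oc f.
Proof. by rewrite compDl compNl. Qed.

Lemma compBr (X Y Z : C) (g : hom Y Z) (f f' : hom X Y) :
  g \oc (f - f') = g \oc f - g \oc f'.
Proof. by rewrite compDr compNr. Qed.

Lemma fmap0 (F : add_functor C) (X Y : C) : fmap F (0 : hom X Y) = 0.
Proof. by apply: (addrI (fmap F 0)); rewrite -fmapD !addr0. Qed.

Lemma fmapN (F : add_functor C) (X Y : C) (f : hom X Y) :
  fmap F (- f) = - fmap F f.
Proof. by apply: (addrI (fmap F f)); rewrite -fmapD !subrr fmap0. Qed.

Lemma fmapB (F : add_functor C) (X Y : C) (f g : hom X Y) :
  fmap F (f - g) = fmap F f - fmap F g.
Proof. by rewrite fmapD fmapN. Qed.

Lemma is_zero_functor (F : add_functor C) (X : C) : is_zero X -> is_zero (F X).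
Proof. by rewrite /is_zero -fmap1 => ->; rewrite fmap0. Qed.

Lemma iso_idm (X : C) : is_iso (idm X).
Proof. by exists (idm X); rewrite comp1m. Qed.

Lemma iso_cancel_r (X Y Z : C) (s : hom X Y) (f g : hom Y Z) :
  is_iso s -> f \oc s = g \oc s -> f = g.
Proof.
by move=> [t [_ st]] E; rewrite -[f]compm1 -[g]compm1 -st !compA E.
Qed.

Lemma iso_cancel_l (X Y Z : C) (s : hom Y Z) (f g : hom X Y) :
  is_iso s -> s \oc f = s \oc g -> f = g.
Proof.
by move=> [t [ts _]] E; rewrite -[f]comp1m -[g]comp1m -ts -!compA E.
Qed.

Lemma coproduct_ext n (F : 'I_n -> C) (W Z : C)
    (inj : forall k, hom (F k) W) (f g : hom W Z) :
  is_coproduct inj -> (forall k, f \oc inj k = g \oc inj k) -> f = g.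
Proof.
move=> cop fg; have [h [_ hU]] := cop Z (fun k => f \oc inj k).
by rewrite -(hU f) // -(hU g).
Qed.

Lemma coproduct0_zero (F : 'I_0 -> C) (W : C) (inj : forall k, hom (F k) W) :
  is_coproduct inj -> is_zero W.
Proof. by move=> cop; apply: (coproduct_ext cop) => -[]. Qed.

Definition faithful (F : add_functor C) : Prop :=
  forall (X Y : C) (f g : hom X Y), fmap F f = fmap F g -> f = g.

Definition full (F : add_functor C) : Prop :=
  forall (X Y : C) (c : hom (F X) (F Y)), exists f, fmap F f = c.

Lemma faithful_of_unit (F G : add_functor C) (u : forall X, hom X (G (F X))) :
    (forall X, is_iso (u X)) ->
    (forall X Y (f : hom X Y), u Y \oc f = fmap G (fmap F f) \oc u X) ->
  faithful F.
Proof.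
move=> u_iso u_nat X Y f g E; apply: (iso_cancel_l (u_iso Y)).
by rewrite !u_nat E.
Qed.

(** Transporting [c] along the unit gives [f] with [G (F f) = G c], and [G] is
    faithful. *)
Lemma full_of_unit (F G : add_functor C) (u : forall X, hom X (G (F X))) :
    (forall X, is_iso (u X)) ->
    (forall X Y (f : hom X Y), u Y \oc f = fmap G (fmap F f) \oc u X) ->
  faithful G -> full F.
Proof.
move=> u_iso u_nat G_faithful X Y c; have [v [_ uv]] := u_iso Y.
exists (v \oc fmap G c \oc u X); apply/G_faithful/(iso_cancel_r (u_iso X)).
by rewrite -u_nat !compA uv comp1m.
Qed.

End Preadditive.

(** * Noetherian objects relative to a family of objects *)

Section Noetherian.
Variables (C : preadditive) (K : Type) (G : K -> C).

(** A subfunctor of [hom _ X] on the full subcategory spanned by the [G k],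
    that is, a submodule over a ring with several objects. *)
Record subfunctor (X : C) (I : forall k, hom (G k) X -> Prop) : Prop :=
  Subfunctor {
    subfunctor0 : forall k, I k 0;
    subfunctorB : forall k x y, I k x -> I k y -> I k (x - y);
    subfunctorM : forall k l (x : hom (G k) X) (t : hom (G l) (G k)),
      I k x -> I l (x \oc t) }.

Definition subfunctor_fin_gen (X : C) (I : forall k, hom (G k) X -> Prop) :=
  exists (m : nat) (d : 'I_m -> K) (g : forall j, hom (G (d j)) X),
    (forall j, I (d j) (g j)) /\
    forall J : forall k, hom (G k) X -> Prop,
      subfunctor J -> (forall j, J (d j) (g j)) ->
      forall k (x : hom (G k) X), I k x -> J k x.

Definition noetherian (X : C) : Prop :=
  forall I : forall k, hom (G k) X -> Prop,
    subfunctor I -> subfunctor_fin_gen I.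

Lemma subfunctorT (X : C) : subfunctor (fun k (_ : hom (G k) X) => True).
Proof. by []. Qed.

Lemma subfunctorI (X : C) (I J : forall k, hom (G k) X -> Prop) :
  subfunctor I -> subfunctor J -> subfunctor (fun k x => I k x /\ J k x).
Proof.
move=> [I0 IB IM] [J0 JB JM]; split=> //.
  by move=> k x y [Ix Jx] [Iy Jy]; split; [apply: IB | apply: JB].
by move=> k l x t [Ix Jx]; split; [apply: IM | apply: JM].
Qed.

Lemma subfunctor_preim (X Y : C) (f : hom X Y)
    (I : forall k, hom (G k) Y -> Prop) :
  subfunctor I -> subfunctor (fun k x => I k (f \oc x)).
Proof.
move=> [I0 IB IM]; split=> [k|k x y Ix Iy|k l x t Ix].
- by rewrite comp0r.
- by rewrite compBr; apply: IB.
- by rewrite compA; apply: IM.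
Qed.

Lemma subfunctor_im (X Y : C) (f : hom X Y)
    (I : forall k, hom (G k) X -> Prop) :
  subfunctor I -> subfunctor (fun k y => exists2 x, I k x & f \oc x = y).
Proof.
move=> [I0 IB IM]; split=> [k|k _ _ [x Ix <-] [y Iy <-]|k l _ t [x Ix <-]].
- by exists 0; rewrite ?comp0r.
- by exists (x - y); [apply: IB | rewrite compBr].
- by exists (x \oc t); [apply: IM | rewrite compA].
Qed.

(** [X] behaves as a quotient of [Y]: generators of the preimage of [I] in [Y]
    map to generators of [I]. *)
Lemma noetherian_retract (X Y : C) :
  retract X Y -> noetherian Y -> noetherian X.
Proof.
move=> [i [r ri]] noethY I sI.
have [m [d [g [Ig genI]]]] := noethY _ (subfunctor_preim r sI).
exists m, d, (fun j => r \oc g j); split=> // J sJ Jg k x Ix.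
have rix : r \oc (i \oc x) = x by rewrite compA ri comp1m.
by rewrite -rix; apply: (genI _ (subfunctor_preim r sJ)) => //; rewrite rix.
Qed.

(** The extension argument for Noetherian modules: generators of [I] are lifts
    of generators of its image in [Z] together with the images of generators of
    its preimage in [X]. *)
Lemma noetherian_extension (X Y Z : C) (f : hom X Y) (g : hom Y Z) :
    (forall k (y : hom (G k) Y), g \oc y = 0 -> exists x, f \oc x = y) ->
  noetherian X -> noetherian Z -> noetherian Y.
Proof.
move=> exact_fg noethX noethZ I sI.
have [m [d [a [Ia genX]]]] := noethX _ (subfunctor_preim f sI).
have [n [e [b [Ib genZ]]]] := noethZ _ (subfunctor_im g sI).
have [c Ic gc] : exists2 c : forall j, hom (G (e j)) Y,
    forall j, I (e j) (c j) & forall j, g \oc c j = b j.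
  exact: (@fin_all_exists2 _ _ (fun j y => I (e j) y)
                               (fun j y => g \oc y = b j)).
pose dd (j : 'I_(m + n)) : K :=
  match split j with inl u => d u | inr v => e v end.
pose gg (j : 'I_(m + n)) : hom (G (dd j)) Y :=
  match split j as s
    return hom (G match s with inl u => d u | inr v => e v end) Y with
  | inl u => f \oc a u
  | inr v => c v
  end.
exists (m + n)%N, dd, gg; split=> [j|J sJ Jgg k y Iy].
  by rewrite /gg /dd; case: (split j) => u; [apply: Ia | apply: Ic].
have Ja u : J (d u) (f \oc a u).
  by have := Jgg (lshift n u); rewrite /gg /dd (unsplitK (inl u)).
have Jc v : J (e v) (c v).
  by have := Jgg (rshift m v); rewrite /gg /dd (unsplitK (inr v)).
(* [y'] has to lie in [I] as well as in [J], so that [y - y'] remains in [I] and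
   comes from the preimage of [I] in [X]. *)
have sIJ := subfunctorI sI sJ.
have [j|y' [Iy' Jy'] gy'] :=
    genZ _ (subfunctor_im g sIJ) _ k (g \oc y) (ex_intro2 _ _ y Iy erefl).
  by exists (c j).
have [|x fx] := exact_fg k (y - y'); first by rewrite compBr gy' subrr.
have Jx : J k (f \oc x).
  apply: (genX _ (subfunctor_preim f sJ)) => //.
  by rewrite fx; apply: (subfunctorB sI).
rewrite -[y](subrK y') -fx -[y']opprK -[- y']sub0r.
by do 2?apply: (subfunctorB sJ) => //; apply: (subfunctor0 sJ).
Qed.

(** By fullness every map [G (tau k) -> F X] has the form [F x \oc s k], so a
    subfunctor for [F X] is determined by its pullback along [F] to one for [X],
    and generators of the pullback give generators of it. *)
Lemma noetherian_functor (F : add_functor C) (tau : K -> K)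
    (s : forall k, hom (G (tau k)) (F (G k))) (X : C) :
    full F -> (forall k, is_iso (s k)) -> (forall l, exists k, l = tau k) ->
  noetherian X -> noetherian (F X).
Proof.
move=> F_full s_iso tau_surj noethX I sI.
have sub_pull (J : forall k, hom (G k) (F X) -> Prop) : subfunctor J ->
    subfunctor (fun k x => J (tau k) (fmap F x \oc s k)).
  move=> [J0 JB JM]; split=> [k|k x y Jx Jy|k l x t Jx].
  - by rewrite fmap0 comp0l.
  - by rewrite fmapB compBl; apply: JB.
  - have [v [_ sv]] := s_iso k.
    have -> : fmap F (x \oc t) \oc s l
            = fmap F x \oc s k \oc (v \oc fmap F t \oc s l).
      by rewrite !compA -[fmap F x \oc s k \oc v]compA sv compm1 fmapM.
    exact: JM.
have [m [d [g [Ig genX]]]] := noethX _ (sub_pull I sI).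
exists m, (fun j => tau (d j)), (fun j => fmap F (g j) \oc s (d j)).
split=> // J sJ Jg l; have [k ->] := tau_surj l => y Iy.
have [v [vs _]] := s_iso k; have [x Fx] := F_full _ _ (y \oc v).
have Ey : y = fmap F x \oc s k by rewrite Fx -compA vs compm1.
by rewrite Ey; apply: (genX _ (sub_pull J sJ)); rewrite // -Ey.
Qed.

End Noetherian.

(** * Exact triangles *)

Section Triangles.
Variable D : triangulated.

Lemma susp_faithful : faithful (@susp D).
Proof. exact: faithful_of_unit (@sunit_iso D) (@sunit_nat D). Qed.

Lemma desusp_faithful : faithful (@desusp D).
Proof. exact: faithful_of_unit (@scunit_iso D) (@scunit_nat D). Qed.

Lemma susp_full : full (@susp D).
Proof. exact: full_of_unit (@sunit_iso D) (@sunit_nat D) desusp_faithful. Qed.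

Lemma desusp_full : full (@desusp D).
Proof. exact: full_of_unit (@scunit_iso D) (@scunit_nat D) susp_faithful. Qed.

Lemma zero_ob_exists : exists Z : D, is_zero Z.
Proof.
have F (k : 'I_0) : D by case: k.
have [Z [inj cop]] := finite_coproducts F.
by exists Z; apply: coproduct0_zero cop.
Qed.

Lemma dist_comp0 (X Y Z : D) (f : hom X Y) (g : hom Y Z) (h : hom Z (susp X)) :
  dist f g h -> g \oc f = 0.
Proof.
move=> T; have [Z0 Z0P] := zero_ob_exists.
have [|c [<- _]] := dist_mor (a := idm X) (b := f) (dist_id X Z0P) T => //.
by rewrite comp0r.
Qed.

Lemma dist_0_id (Z0 Z : D) : is_zero Z0 ->
  dist (0 : hom Z0 Z) (idm Z) (0 : hom Z (susp Z0)).
Proof.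
move=> Z0P; apply/dist_rot; rewrite fmap0 oppr0.
exact/dist_id/is_zero_functor.
Qed.

(** Compare the rotated triangle of [idm T] with the rotated triangle of [f];
    the third map is a lift of [Sigma y], and desuspends. *)
Lemma dist_lift (T X Y Z : D)
    (f : hom X Y) (g : hom Y Z) (h : hom Z (susp X)) (y : hom T Y) :
  dist f g h -> g \oc y = 0 -> exists x, f \oc x = y.
Proof.
move=> /dist_rot tri gy; have [Z0 Z0P] := zero_ob_exists.
have /dist_rot triT := dist_id T Z0P.
have [|c [_ Ec]] := dist_mor (a := y) (b := 0 : hom Z0 Z) triT tri.
  by rewrite gy comp0l.
have [x Ex] := susp_full c; exists x; apply: susp_faithful; apply: oppr_inj.
by rewrite fmapM Ex -compNl -Ec compNr fmap1 compm1.
Qed.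

Lemma dist_extend (X Y Z V : D)
    (f : hom X Y) (g : hom Y Z) (h : hom Z (susp X)) (y : hom Y V) :
  dist f g h -> y \oc f = 0 -> exists z, z \oc g = y.
Proof.
move=> tri yf; have [Z0 Z0P] := zero_ob_exists.
have [|z [Ez _]] :=
    dist_mor (a := 0 : hom X Z0) (b := y) tri (dist_0_id V Z0P).
  by rewrite comp0r.
by exists z; rewrite Ez comp1m.
Qed.

(** The suspension of [f] is still split mono, and kills [h]. *)
Lemma dist_split_mono (X Y Z : D)
    (f : hom X Y) (g : hom Y Z) (h : hom Z (susp X)) (r : hom Y X) :
  dist f g h -> r \oc f = idm X -> h = 0.
Proof.
move=> /dist_rot /dist_rot /dist_comp0; rewrite compNl => /eqP.
rewrite oppr_eq0 => /eqP fh rf.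
by rewrite -[h]comp1m -fmap1 -rf fmapM -compA fh comp0r.
Qed.

(** The cofiber of the inclusion of the first summand is a coproduct of the
    remaining ones: maps out of it exist because maps vanishing on that summand
    extend, and are unique because the connecting map is zero. *)
Lemma coproduct_cofiber n (F : 'I_n.+1 -> D) (W Z : D)
    (inj : forall k, hom (F k) W) (g : hom W Z) (h : hom Z (susp (F ord0))) :
  is_coproduct inj -> dist (inj ord0) g h ->
  is_coproduct (fun k => g \oc inj (lift ord0 k)).
Proof.
move=> cop tri.
have extend V (u : hom (F ord0) V) (w : forall k, hom (F (lift ord0 k)) V) :
    exists t : hom W V,
      t \oc inj ord0 = u /\ forall k, t \oc inj (lift ord0 k) = w k.
  have [uw [uw0 uwS]] :=
    ord_fun_cons (T := fun k => hom (F k) V) u w.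
  have [t [tE _]] := cop V uw; exists t.
  by split=> [|k]; rewrite tE.
have [r [r0 _]] := extend _ (idm (F ord0)) (fun=> 0).
have h0 := dist_split_mono tri r0.
move=> V w; have [t [t0 tw]] := extend V 0 w.
have [z zg] := dist_extend tri t0.
exists z; split=> [k|z' z'w]; first by rewrite compA zg tw.
have zz'g : (z - z') \oc g = 0.
  apply: (coproduct_ext cop) => k; rewrite comp0l.
  case: (unliftP ord0 k) => [j ->|->].
    by rewrite -compA compBl z'w compA zg tw subrr.
  by rewrite -compA (dist_comp0 tri) comp0r.
have /dist_rot tri' := tri; have [v Ev] := dist_extend tri' zz'g.
by apply/eqP; rewrite -subr_eq0 -Ev h0 comp0r.
Qed.

End Triangles.

(** * Shifts of [S], finite wedges and the thick subcategory *)

Section Thick.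
Variables (D : triangulated) (S : D).

Let spheres (i : int) : D := shift D i S.

Lemma shift_succ_iso i (X : D) : is_iso (shift_succ i X).
Proof.
by case: i => [n|[|n]] /=; [apply: iso_idm | apply: scunit_iso..].
Qed.

Lemma shift_pred_iso i (X : D) : is_iso (shift_pred i X).
Proof.
by case: i => [[|n]|n] /=; [apply: iso_idm | apply: sunit_iso | apply: iso_idm].
Qed.

Lemma noetherian_thick : is_thick (noetherian spheres).
Proof.
have Nsusp X : noetherian spheres X -> noetherian spheres (susp X).
  apply: (noetherian_functor (tau := zsucc) (s := fun i => shift_succ i S)).
  - exact: susp_full.
  - by move=> i; apply: shift_succ_iso.
  - by move=> i; exists (i - 1); rewrite zsuccE subrK.
have Ndesusp X : noetherian spheres X -> noetherian spheres (desusp X).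
  apply: (noetherian_functor (tau := zpred) (s := fun i => shift_pred i S)).
  - exact: desusp_full.
  - by move=> i; apply: shift_pred_iso.
  - by move=> i; exists (i + 1); rewrite zpredE addrK.
have Ncof2 X Y Z (f : hom X Y) (g : hom Y Z) h :
    dist f g h -> noetherian spheres X -> noetherian spheres Z ->
    noetherian spheres Y.
  by move=> tri; apply: noetherian_extension => i y; apply: dist_lift tri.
split=> //.
- by move=> X Y; apply: noetherian_retract.
- move=> X Y Z f g h /dist_rot tri NX NY.
  by apply: Ncof2 tri NY _; apply: Nsusp.
- move=> X Y Z f g h /dist_rot /dist_rot tri NY NZ.
  (* The rotated triangle treats [Sigma X], and [X] is a retract of the
     desuspension of [Sigma X]. *)
  have NsX := Ncof2 _ _ _ _ _ _ tri NZ (Nsusp _ NY).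
  apply: noetherian_retract (Ndesusp _ NsX).
  by have [v [vu _]] := sunit_iso X; exists (sunit X), v.
Qed.

(** The right multiplication of [pi_* S] is composition with a map between
    suspensions of [S], so every subfunctor is a right ideal. *)
Lemma noetherian_sphere : pi_noetherian S -> noetherian spheres S.
Proof.
move=> noethS I [I0 IB IM].
have right_ideal_of (J : forall n, pi S n S -> Prop) :
    @subfunctor D int spheres S J -> right_ideal J.
  move=> [J0 JB JM]; split=> // i j x r Jx.
  by rewrite /pi_mul -compA; apply: JM.
have [m [d [g [Ig gen]]]] := noethS I (right_ideal_of I (Subfunctor I0 IB IM)).
exists m, d, g; split=> // J sJ; apply: gen; exact: right_ideal_of.
Qed.

Lemma noetherian_of_thick (X : D) :
  pi_noetherian S -> thick S X -> noetherian spheres X.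
Proof.
move=> noethS tX; apply: tX; first exact: noetherian_thick.
exact: noetherian_sphere.
Qed.

Lemma thick_shift (P : D -> Prop) i : is_thick P -> P S -> P (shift D i S).
Proof.
move=> tP PS; case: i => n; last rewrite /= -/(functor_iter desusp n).
  by elim: n => [//|n IHn]; apply: (thick_susp tP).
by apply: (thick_desusp tP); elim: n => [//|n IHn]; apply: (thick_desusp tP).
Qed.

(** By induction on the number of summands, a coproduct being an extension of
    the coproduct of all summands but the first by the first one. *)
Lemma thick_coproduct (P : D -> Prop) n (F : 'I_n -> D) (W : D)
    (inj : forall k, hom (F k) W) :
  is_thick P -> P S -> (forall k, P (F k)) -> is_coproduct inj -> P W.
Proof.
move=> tP PS; elim: n F W inj => [|n IHn] F W inj PF cop.
  by apply: (thick_cof3 tP (dist_id S (coproduct0_zero cop))).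
have [Z [g [h tri]]] := dist_cone (inj ord0).
apply: (thick_cof2 tP tri) => //.
by apply: IHn (coproduct_cofiber cop tri) => k.
Qed.

Lemma thick_wedge (W : D) : finite_wedge S W -> thick S W.
Proof.
move=> [n [d [inj cop]]] P tP PS; apply: thick_coproduct cop => // k.
exact: thick_shift.
Qed.

Lemma eq0_retract_wedge (X Y W : D) (f : hom X Y) :
    finite_wedge S W -> retract X W ->
  (forall i (x : pi S i X), pi_map f x = 0) -> f = 0.
Proof.
move=> [n [d [inj cop]]] [i [r ri]] f0.
rewrite -[f]compm1 -ri compA.
rewrite (coproduct_ext (f := f \oc r) (g := 0) cop) ?comp0l // => k.
by rewrite comp0l -compA; apply: f0.
Qed.

(** The wedge is indexed by generators of [pi_* X]; the image of [pi_* p] is a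
    subfunctor containing them. *)
Lemma wedge_surj (X : D) : noetherian spheres X ->
  exists (W : D) (p : hom W X), finite_wedge S W /\
    forall i (x : pi S i X), exists w, p \oc w = x.
Proof.
move=> noethX; have [m [d [g [_ gen]]]] := noethX _ (subfunctorT spheres X).
have [W [inj cop]] := finite_coproducts (fun k => shift D (d k) S).
have [p [pE _]] := cop X g; exists W, p; split=> [|i x].
  by exists m, d, inj.
have [j|w _ pw] := gen _ (subfunctor_im p (subfunctorT spheres W)) _ i x I.
  by exists (inj j) => //; apply: pE.
by exists w.
Qed.

(** Under the generating hypothesis the cofiber map of [p] vanishes, and then
    the identity of [X] lifts along [p]. *)
Lemma retract_of_surj (X W : D) (p : hom W X) :
    generating_hypothesis S -> thick S X -> thick S W ->
  (forall i (x : pi S i X), exists w, p \oc w = x) -> retract X W.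
Proof.
move=> GH tX tW p_surj; have [Z [g [h tri]]] := dist_cone p.
have tZ : thick S Z.
  by move=> P tP PS; apply: (thick_cof3 tP tri); [apply: tW | apply: tX].
have g0 : g = 0.
  apply: (GH _ _ _ tX tZ) => i x; have [w <-] := p_surj i x.
  by rewrite /pi_map compA (dist_comp0 tri) comp0l.
have [|s ps] := dist_lift (y := idm X) tri; first by rewrite g0 comp0l.
by exists s, p.
Qed.

End Thick.

Theorem proposition5p2 (D : triangulated) (S : D)
    (S_noetherian : pi_noetherian S) :
  generating_hypothesis S <->
  (forall X : D,
     thick S X <-> exists W : D, finite_wedge S W /\ retract X W).
Proof.
split=> [GH X|thickE X Y f tX _ f0].
  split=> [tX|[W [wW XW]]].
    have [W [p [wW p_surj]]] :=
      wedge_surj (noetherian_of_thick S_noetherian tX).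
    exists W; split=> //.
    exact: retract_of_surj GH tX (thick_wedge wW) p_surj.
  by move=> P tP PS; apply: (thick_retract tP XW); exact: (thick_wedge wW).
have [W [wW XW]] := (thickE X).1 tX.
exact: eq0_retract_wedge wW XW f0.
Qed.
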